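(* Let $k\ge 1$ be an integer. There is a bijection between the large $(k,k)$-Fuss-Schröder paths of length $n$ and the $(n,k)$-valid forests, for each positive integer $n$, which preserves type. Furthermore, under this bijection, small paths correspond exactly to the $(n,k)$-valid forests in which the second tree is a single vertex, and paths ending with a diagonal step correspond exactly to the $(n,k)$-valid forests in which the first tree is a single vertex.
   Context: Paths. A large $(k,k)$-Fuss-Schröder path of length $n$ is a lattice path from $(0,0)$ to $(n,kn)$ using east steps $(1,0)$, north steps $(0,1)$ and diagonal steps $(1,1)$, which stays nonstrictly above the line $y=kx$, and such that each diagonal step goes from the line $y=kj+k-1$ to the line $y=kj+k$ for some integer $j$. It is small if no diagonal step touches the line $y=kx$. The type of a path is the partition whose parts are the lengths of the maximal runs of consecutive east steps. Forests. A rooted plane tree is a rooted tree in which each vertex has a linearly ordered list of children; a rooted plane forest is a linearly ordered list of rooted plane trees. The vertices of a rooted plane forest with $V$ vertices are labeled $0,1,\dots,V-1$ in pre-order (each vertex is labeled before its descendants, children's subtrees are processed in order, and the trees of the forest are processed in order). An $(n,k)$-valid forest is a rooted plane forest with $2+(k+1)n$ vertices and $(k+1)n$ edges such that: (1) it consists of two rooted plane trees (a first and a second one); (2) every vertex whose pre-order label $s$ satisfies $s\equiv 1\pmod{k+1}$ has either $0$ or $k+1$ children; (3) every vertex whose label $s$ satisfies $s\not\equiv 1\pmod{k+1}$ has $m(k+1)$ children for some nonnegative integer $m$. The type of an $(n,k)$-valid forest is the partition formed by all positive integers $m$ (with repetition) arising from vertices in category (3) with $m(k+1)$ children. *)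

(* Defs.v *)
From HB Require Import structures.
From mathcomp Require Import all_boot.

Set Implicit Arguments.
Unset Strict Implicit.
Unset Printing Implicit Defensive.

Inductive step := East | North | Diag.

Definition is_east (s : step) : bool := if s is East then true else false.
Definition is_diag (s : step) : bool := if s is Diag then true else false.

(* Only steps with nonnegative coordinates are used and paths start at (0, 0),
   so lattice points can be taken in nat * nat. *)
Definition move (q : nat * nat) (s : step) : nat * nat :=
  match s with
  | East => (q.1.+1, q.2)
  | North => (q.1, q.2.+1)
  | Diag => (q.1.+1, q.2.+1)
  end.

(* The lattice points visited by a path after each of its steps. *)
Definition ends (p : seq step) : seq (nat * nat) := scanl move (0, 0) p.

Definition points (p : seq step) : seq (nat * nat) := (0, 0) :: ends p.

(* The start and end points of the diagonal steps of a path. *)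
Definition diag_steps (p : seq step) : seq ((nat * nat) * (nat * nat)) :=
  [seq e.2 | e <- zip p (zip (points p) (ends p)) & is_diag e.1].

Definition weakly_above (k : nat) (q : nat * nat) : bool := k * q.1 <= q.2.

Definition on_line (k : nat) (q : nat * nat) : bool := q.2 == k * q.1.

(* For k >= 1, the congruence says that a diagonal step starts on a line
   y = k j + (k - 1), hence ends on the line y = k j + k; as heights are
   nonnegative, j ranges over nat. *)
Definition is_large_path (k n : nat) (p : seq step) : bool :=
  [&& last (0, 0) (points p) == (n, k * n),
      all (weakly_above k) (points p)
    & all (fun d => d.1.2 == k.-1 %[mod k]) (diag_steps p)].

(* A segment lying weakly above the line y = k x touches it if and only if one
   of its endpoints is on it. *)
Definition is_small (k : nat) (p : seq step) : bool :=
  all (fun d => ~~ on_line k d.1 && ~~ on_line k d.2) (diag_steps p).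

Definition ends_with_diag (p : seq step) : Prop := exists q, p = rcons q Diag.

(* Lengths of the maximal runs of consecutive east steps, interspersed with
   zeros; r is the length of the run being read. *)
Fixpoint east_runs (r : nat) (p : seq step) : seq nat :=
  match p with
  | [::] => [:: r]
  | s :: p' => if is_east s then east_runs r.+1 p' else r :: east_runs 0 p'
  end.

(* Partitions are represented as weakly decreasing lists of positive parts. *)
Definition partition_of (s : seq nat) : seq nat :=
  sort geq [seq m <- s | 0 < m].

Definition path_type (p : seq step) : seq nat := partition_of (east_runs 0 p).

Inductive tree := Node of seq tree.

Definition forest := seq tree.

Definition vertex : tree := Node [::].

(* The numbers of children of the vertices, listed in pre-order. *)
Fixpoint tree_arities (t : tree) : seq nat :=
  let: Node ts := t in size ts :: flatten (map tree_arities ts).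

Definition arities (F : forest) : seq nat := flatten (map tree_arities F).

Definition nb_vertices (F : forest) : nat := size (arities F).

(* Each edge is counted at its parent endpoint. *)
Definition nb_edges (F : forest) : nat := sumn (arities F).

(* The number of children of the vertex with pre-order label s. *)
Definition nb_children (F : forest) (s : nat) : nat := nth 0 (arities F) s.

Definition labels (F : forest) : seq nat := iota 0 (nb_vertices F).

Definition special (k s : nat) : bool := s == 1 %[mod k.+1].

Definition is_valid_forest (n k : nat) (F : forest) : bool :=
  [&& nb_vertices F == 2 + k.+1 * n,
      nb_edges F == k.+1 * n,
      size F == 2,
      all (fun s => special k s ==>
             (nb_children F s == 0) || (nb_children F s == k.+1)) (labels F)
    & all (fun s => ~~ special k s ==> (k.+1 %| nb_children F s)) (labels F)].

Definition forest_type (k : nat) (F : forest) : seq nat :=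
  partition_of
    [seq nb_children F s %/ k.+1 | s <- labels F & ~~ special k s].

Definition first_tree_single (F : forest) : Prop :=
  exists t, F = [:: vertex; t].

Definition second_tree_single (F : forest) : Prop :=
  exists t, F = [:: t; vertex].

Definition large_path (k n : nat) : Type := {p : seq step | is_large_path k n p}.

Definition valid_forest (n k : nat) : Type := {F : forest | is_valid_forest n k F}.

(* Main.v *)
(* Let e_h be the length of the run of east steps at height h and let d_j be 1
   if the step arriving at height k j is diagonal, 0 if it is a north step
   (d_0 = 0). A path is encoded by the word
     d_0, e_0 .. e_(k-1), d_1, e_k .. e_(2k-1), d_2, .., d_n, e_(kn).
   Multiplied by k+1 and reversed, this word is the list of the numbers of
   children, in pre-order, of the corresponding forest: the letters d_j are
   exactly those in special position. Reading the word forwards builds the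
   forest from a stack of trees, the letter c making k+1 times c trees of the
   stack the children of a new root; that the stack never underflows says
   precisely that the path stays weakly above y = k x. The last tree is a single
   vertex when the tree planted by d_0 is never used again, and this happens
   when no diagonal step touches y = k x. *)

Require Import Defs.
From mathcomp Require Import all_boot.
From mathcomp Require Import zify.

Set Implicit Arguments.
Unset Strict Implicit.
Unset Printing Implicit Defensive.

Lemma tree_forest_ind (P : tree -> Prop) (Q : forest -> Prop) :
    (forall ts, Q ts -> P (Node ts)) -> Q [::] ->
    (forall t ts, P t -> Q ts -> Q (t :: ts)) ->
  forall F, Q F.
Proof.
move=> PNode Q0 Qcons.
have PT : forall t, P t.
  fix IH 1; case=> ts; apply: PNode.
  by elim: ts => [|t ts IHts]; [exact: Q0 | apply: Qcons; [exact: IH | exact: IHts]].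
by elim=> [|t ts IHts]; [exact: Q0 | apply: Qcons].
Qed.

(** * Forests and words *)

Section Planting.

Variable k : nat.

Definition push (st : forest) (c : nat) : forest :=
  Node (take (k.+1 * c) st) :: drop (k.+1 * c) st.

Definition plant (st : forest) (w : seq nat) : forest := foldl push st w.

(** [b] is the current stack size; each push removes [k.+1 * c] trees and puts one back. *)
Fixpoint feasible (b : nat) (w : seq nat) : bool :=
  if w is c :: w' then (k.+1 * c <= b) && feasible (b - k.+1 * c).+1 w'
  else true.

Definition reading (F : forest) : seq nat :=
  rev [seq a %/ k.+1 | a <- arities F].

(** * Planting and reading are mutually inverse *)

Lemma plant_catr st w1 w2 : plant st (w1 ++ w2) = plant (plant st w1) w2.
Proof. exact: foldl_cat. Qed.

Lemma size_push st c : size (push st c) = (size st - k.+1 * c).+1.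
Proof. by rewrite /= size_drop. Qed.

Lemma feasible_cat st w1 w2 :
  feasible (size st) (w1 ++ w2) =
  feasible (size st) w1 && feasible (size (plant st w1)) w2.
Proof.
elim: w1 st => //= c w1 IH st.
by rewrite -size_push IH andbA.
Qed.

Lemma size_plant st w : feasible (size st) w ->
  size (plant st w) + k.+1 * sumn w = size st + size w.
Proof.
elim: w st => [|c w IH] st /=; first by rewrite muln0 addn0.
rewrite -size_push => /andP[lec /IH]; rewrite /plant size_push => E.
by rewrite mulnDr addnCA E; lia.
Qed.

Lemma arities_cat F G : arities (F ++ G) = arities F ++ arities G.
Proof. by rewrite /arities map_cat flatten_cat. Qed.

(** The children of a new root are the top of the stack, so a push only puts one arity in front of
    those already present. *)
Lemma arities_plant st w : feasible (size st) w ->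
  arities (plant st w) = rev [seq k.+1 * c | c <- w] ++ arities st.
Proof.
elim: w st => [|c w IH] st //=.
rewrite -size_push => /andP[lec /IH ->].
rewrite rev_cons cat_rcons; congr (_ ++ _).
by rewrite {1}/arities /= size_takel // -arities_cat cat_take_drop.
Qed.

Lemma plant_cat st st0 w : feasible (size st) w ->
  plant (st ++ st0) w = plant st w ++ st0.
Proof.
elim: w st => [|c w IH] st //=.
rewrite -size_push => /andP[lec /IH <-]; congr foldl.
by rewrite /push take_cat drop_cat; case: ltngtP lec => // -> _;
  rewrite subnn take0 drop0 cats0 take_size drop_size.
Qed.

Lemma reading_plant w : feasible 0 w -> reading (plant [::] w) = w.
Proof.
move=> ok; rewrite /reading (@arities_plant [::]) // cats0 map_rev revK.
by rewrite -map_comp map_id_in // => c _ /=; rewrite mulKn.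
Qed.

Lemma reading_cons t ts :
  reading (t :: ts) = reading ts ++ reading [:: t].
Proof. by rewrite /reading /arities /= cats0 map_cat rev_cat. Qed.

Lemma reading_node ts :
  reading [:: Node ts] = rcons (reading ts) (size ts %/ k.+1).
Proof. by rewrite /reading /arities /= cats0 rev_cons. Qed.

(** Reversed pre-order meets later trees first and each root after its descendants, so the word of a
    tree has the net effect of stacking that tree. The stack must be arbitrary because [t] is built
    on top of [ts ++ st]. *)
Lemma plant_reading F st : all (dvdn k.+1) (arities F) ->
  plant st (reading F) = F ++ st /\ feasible (size st) (reading F).
Proof.
move: F st; apply: (tree_forest_ind (P := fun t => forall st,
  all (dvdn k.+1) (arities [:: t]) -> plant st (reading [:: t]) = t :: st /\
  feasible (size st) (reading [:: t]))) => [ts IH st||t ts IHt IHts st].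
- rewrite /arities /= cats0 => /andP[dv_ts /(IH st)[eq_ts ok_ts]].
  rewrite reading_node -cats1 feasible_cat ok_ts plant_catr eq_ts /=.
  rewrite /push mulnC divnK // size_cat leq_addr.
  by rewrite take_size_cat // drop_size_cat.
- by [].
rewrite -cat1s arities_cat all_cat => /andP[dv_t /(IHts st)[eq_ts ok_ts]].
rewrite /= reading_cons feasible_cat ok_ts plant_catr eq_ts.
by have [-> ->] := IHt (ts ++ st) dv_t.
Qed.

(* [t] is the position of the first letter of [w] in a whole word; the letters
   d_j are those at multiples of [k.+1]. *)
Definition binary_at (t : nat) (w : seq nat) : bool :=
  all (fun i => (k.+1 %| t + i) ==> (nth 0 w i <= 1)) (iota 0 (size w)).

Lemma binary_at_cons t c w :
  binary_at t (c :: w) = ((k.+1 %| t) ==> (c <= 1)) && binary_at t.+1 w.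
Proof.
rewrite /binary_at /= addn0 (iotaDl 1) all_map; congr (_ && _).
by apply: eq_all => i /=; rewrite add1n addnS addSn.
Qed.

Definition ordinary_at (t : nat) (w : seq nat) : seq nat :=
  [seq nth 0 w i | i <- iota 0 (size w) & ~~ (k.+1 %| t + i)].

Lemma ordinary_at_cons t c w :
  ordinary_at t (c :: w) =
  if k.+1 %| t then ordinary_at t.+1 w else c :: ordinary_at t.+1 w.
Proof.
rewrite /ordinary_at /= addn0 (iotaDl 1) filter_map.
rewrite (eq_filter (a2 := fun i => ~~ (k.+1 %| t.+1 + i))) => [|i /=];
  last by rewrite add1n addnS addSn.
by case: (k.+1 %| t) => /=; rewrite -map_comp.
Qed.

(** * Words matched with valid forests *)

Definition is_word (n : nat) (w : seq nat) : bool :=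
  [&& size w == 2 + k.+1 * n, sumn w == n, binary_at 0 w & feasible 0 w].

(** The reversed position is congruent to [1 - t] modulo [k.+1]. *)
Lemma special_rev n t : 0 < k -> t < 2 + k.+1 * n ->
  special k (2 + k.+1 * n - t.+1) = (k.+1 %| t).
Proof.
move=> k0 lt; rewrite /special -(eqn_modDr t).
have -> : 2 + k.+1 * n - t.+1 + t = n * k.+1 + 1 by lia.
rewrite modnMDl -[X in X %% _ == _]addn0 eqn_modDl mod0n eq_sym.
by [].
Qed.

Lemma sumn_scale w : sumn [seq k.+1 * c | c <- w] = k.+1 * sumn w.
Proof. by elim: w => [|c w IH] /=; rewrite ?muln0 // IH mulnDr. Qed.

Lemma nb_children_plant n w s : is_word n w -> s < 2 + k.+1 * n ->
  nb_children (plant [::] w) s = k.+1 * nth 0 w (2 + k.+1 * n - s.+1).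
Proof.
case/and4P=> /eqP sz _ _ ok lt.
rewrite /nb_children (@arities_plant [::]) // cats0 nth_rev ?size_map ?sz //.
by rewrite (nth_map 0) // sz; lia.
Qed.

Lemma nb_vertices_plant n w : is_word n w ->
  nb_vertices (plant [::] w) = 2 + k.+1 * n.
Proof.
case/and4P=> /eqP sz _ _ ok.
by rewrite /nb_vertices (@arities_plant [::]) // cats0 size_rev size_map.
Qed.

Lemma is_valid_forest_plant n w : 0 < k -> is_word n w ->
  is_valid_forest n k (plant [::] w).
Proof.
move=> k0 okw; have := okw; case/and4P=> /eqP sz /eqP sm bin ok.
rewrite /is_valid_forest /labels (nb_vertices_plant okw) eqxx andTb.
apply/and4P; split.
- rewrite /nb_edges (@arities_plant [::]) // cats0 sumn_rev sumn_scale.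
  by rewrite sm.
(* Each letter adds one tree and each unit of the sum consumes [k.+1]: two trees remain. *)
- by have := @size_plant [::] w ok; rewrite sz sm add0n => /eqP; rewrite eqn_add2r.
- apply/allP => s; rewrite mem_iota leq0n add0n => lt; apply/implyP => sp.
  rewrite (nb_children_plant okw) //.
  have lt' : 2 + k.+1 * n - s.+1 < 2 + k.+1 * n by lia.
  move/allP/(_ (2 + k.+1 * n - s.+1)): bin; rewrite mem_iota sz lt' => /(_ isT).
  rewrite add0n -(special_rev k0 lt').
  have -> : 2 + k.+1 * n - (2 + k.+1 * n - s.+1).+1 = s by lia.
  by rewrite sp /=; case: (nth _ _ _) => [|[|]] //= _; rewrite ?muln0 ?muln1 ?eqxx ?orbT.
- apply/allP => s; rewrite mem_iota leq0n add0n => lt; apply/implyP => _.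
  by rewrite (nb_children_plant okw) // dvdn_mulr.
Qed.

Lemma valid_forest_dvdn n F : is_valid_forest n k F ->
  all (dvdn k.+1) (arities F).
Proof.
case/and5P=> _ _ _ /allP sp /allP or; apply/(all_nthP 0) => s lt.
have sL : s \in labels F by rewrite mem_iota.
have := sp s sL; have := or s sL; rewrite /nb_children.
by case: (special k s) => //= _ /orP[] /eqP ->.
Qed.

Lemma is_word_reading n F : 0 < k -> is_valid_forest n k F ->
  is_word n (reading F).
Proof.
move=> k0 vF; have dv := valid_forest_dvdn vF.
have [eqF okF] := plant_reading [::] dv.
case/and5P: vF; rewrite /nb_vertices /nb_edges => /eqP sz /eqP ed /eqP sF /allP sp _.
have szr : size (reading F) = 2 + k.+1 * n by rewrite /reading size_rev size_map.
rewrite /is_word szr eqxx okF andbT /=; apply/andP; split.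
  (* The same balance read backwards: two trees and the known length force the sum. *)
  have := size_plant okF; rewrite eqF cats0 sF szr /= => /eqP.
  by rewrite add0n eqn_add2l eqn_mul2l.
apply/allP => t; rewrite mem_iota leq0n add0n szr => lt; apply/implyP => dt.
rewrite nth_rev ?size_map ?sz // (nth_map 0) ?sz; last by lia.
have := sp (2 + k.+1 * n - t.+1); rewrite mem_iota /nb_vertices sz (special_rev k0 lt) dt /=.
rewrite /nb_children add0n => /(_ _)/orP[|/eqP -> | /eqP ->]; [by lia | by rewrite div0n | by rewrite divnn].
Qed.

Lemma perm_iota_rev m : perm_eq (iota 0 m) [seq m - t.+1 | t <- iota 0 m].
Proof.
apply: uniq_perm; first exact: iota_uniq.
  by rewrite map_inj_in_uniq ?iota_uniq // => x y; rewrite !mem_iota; lia.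
move=> x; apply/idP/mapP => [|[y]]; rewrite !mem_iota; last by lia.
by move=> lt; exists (m - x.+1); rewrite ?mem_iota; lia.
Qed.

Lemma forest_type_plant n w : 0 < k -> is_word n w ->
  forest_type k (plant [::] w) = partition_of (ordinary_at 0 w).
Proof.
move=> k0 okw; have := okw; case/and4P=> /eqP sz _ _ _.
rewrite /forest_type /labels (nb_vertices_plant okw) /partition_of.
apply/perm_sortP; [by move=> x y; exact: leq_total|by move=> y x z /= h1 h2; exact: leq_trans h2 h1|
  by move=> x y /= /andP[h1 h2]; apply/eqP; rewrite eqn_leq h1 h2|].
apply: perm_filter; rewrite /ordinary_at sz.
set V := 2 + _.
apply: (perm_trans (perm_map _ (perm_filter _ (perm_iota_rev V)))).
rewrite filter_map -map_comp -(eq_in_filter (a1 := fun i => ~~ (k.+1 %| 0 + i))); last first.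
  by move=> t; rewrite mem_iota leq0n add0n => lt; congr (~~ _); exact/esym/special_rev.
set s1 := map _ _; set s2 := map _ _; suff -> : s1 = s2 by [].
apply/eq_in_map => t.
rewrite mem_filter mem_iota leq0n add0n => /andP[_ lt].
rewrite /= (nb_children_plant okw) ?mulKn //; last by rewrite -/V; lia.
by congr nth; rewrite -/V; lia.
Qed.

(** The first letter plants a vertex at the bottom of the stack; it survives as the last tree when
    the other letters can do without it. *)
Lemma second_tree_singleP n F : is_valid_forest n k F ->
  second_tree_single F <-> feasible 0 (behead (reading F)).
Proof.
move=> vF; have dv := valid_forest_dvdn vF.
have [eqF okF] := plant_reading [::] dv; rewrite cats0 in eqF.
have szF : size F = 2 by case/and5P: vF => _ _ /eqP.
split=> [[t eF]|].
  subst F; rewrite reading_cons /= -[feasible _ _]/(feasible (size (Nil tree)) _).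
  apply: (@plant_reading _ [::] _).2.
  by move: dv; rewrite -cat1s arities_cat all_cat => /andP[].
case E : (reading F) => [|c w] /= ok; first by rewrite -eqF E in szF.
move: okF eqF; rewrite E /= => /andP[]; rewrite leqn0 muln_eq0 /= => /eqP -> _.
rewrite /push muln0 take0 drop0 -/(plant _ _) -[[:: _]]/([::] ++ [:: vertex]).
rewrite plant_cat // => eqF.
move: szF; rewrite -eqF size_cat addn1 => -[].
by case: (plant _ _) => [|t []] // _; exists t.
Qed.

Lemma first_tree_singleP n F : is_valid_forest n k F ->
  first_tree_single F <-> last 0 (reading F) = 0.
Proof.
move=> vF; have dv := valid_forest_dvdn vF.
have szF : size F = 2 by case/and5P: vF => _ _ /eqP.
case: F vF dv szF => [|[ts] [|t []]] // vF dv _.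
rewrite reading_cons reading_node last_cat last_rcons.
have dv_ts : k.+1 %| size ts by case/andP: dv.
split=> [[t' [-> _]] | E]; first by rewrite div0n.
exists t; suff /size0nil -> : size ts = 0 by [].
by rewrite -(divnK dv_ts) E.
Qed.

End Planting.

(** * Paths and words *)

Section Coding.

Variable k : nat.
Hypothesis k_gt0 : 0 < k.

(** [h] is the current height and [r] the part of the current run already read. The letter [d_0] is
    left to [word]. *)
Fixpoint runs (h r : nat) (p : seq step) : seq nat :=
  if p is s :: p' then
    if is_east s then runs h r.+1 p'
    else r :: if k %| h.+1 then (is_diag s : nat) :: runs h.+1 0 p'
              else runs h.+1 0 p'
  else [:: r].

Fixpoint unruns (h : nat) (w : seq nat) : seq step :=
  if w is r :: w' then
    nseq r East ++
    (if w' is d :: w'' then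
       if k %| h.+1 then (if d == 0 then North else Diag) :: unruns h.+1 w''
       else North :: unruns h.+1 w'
     else [::])
  else [::].

Definition diag_steps_from (q : nat * nat) (p : seq step) :=
  [seq e.2 | e <- zip p (zip (q :: scanl move q p) (scanl move q p))
           & is_diag e.1].

Definition diags_ok (q : nat * nat) (p : seq step) : bool :=
  all (fun d => k %| d.1.2.+1) (diag_steps_from q p).

Lemma diags_ok_cons q s p : diags_ok q (s :: p) =
  (is_diag s ==> (k %| q.2.+1)) && diags_ok (move q s) p.
Proof. by case: s. Qed.

(** [(h + h %/ k).+1] is the position of [e_h]: it follows [h] run letters and the letters [d_0] to
    [d_(h %/ k)]. *)
Lemma ndvd_slot h : (k.+1 %| (h + h %/ k).+1) = false.
Proof.
apply/negbTE; rewrite {1}(divn_eq h k).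
have -> : (h %/ k * k + h %% k + h %/ k).+1 = h %/ k * k.+1 + (h %% k).+1 by lia.
rewrite dvdn_addr ?dvdn_mull //; have := ltn_pmod h k_gt0.
by move=> lt; rewrite gtnNdvd.
Qed.

Lemma dvd_slot h : (k.+1 %| (h + h %/ k).+2) = (k %| h.+1).
Proof.
rewrite [in RHS](divn_eq h k) {1}(divn_eq h k).
have -> : (h %/ k * k + h %% k + h %/ k).+2 = h %/ k * k.+1 + (h %% k).+2 by lia.
rewrite -addnS !dvdn_addr ?dvdn_mull //; have := ltn_pmod h k_gt0.
rewrite leq_eqVlt => /orP[/eqP ->|lt]; first by rewrite !dvdnn.
by rewrite !gtnNdvd.
Qed.

(** If [h = q * k + s] with [s < k], the left bound is [q * k.+1 + s.+1] with [s.+1 < k.+1], so both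
    sides say [x <= q]. *)
Lemma above_slot h x : (k.+1 * x <= (h + h %/ k).+1) = (k * x <= h).
Proof.
rewrite [k * x]mulnC -(leq_divRL x h k_gt0); have := ltn_pmod h k_gt0.
have E := divn_eq h k; move: (h %/ k) (h %% k) E => q r -> lt.
case: (leqP x q) => [/(leq_mul (leqnn k.+1))|/(leq_mul (leqnn k.+1))]; lia.
Qed.

Lemma slotS h : (h.+1 + h.+1 %/ k) = (h + h %/ k).+1 + (k %| h.+1).
Proof. by rewrite divnS //; lia. Qed.

Lemma runs_nseq h r e p : runs h r (nseq e East ++ p) = runs h (r + e) p.
Proof. by elim: e r => [|e IH] r /=; rewrite ?addn0 // IH addSnnS. Qed.

Lemma unruns_runs x h r p : diags_ok (x, h) p ->
  unruns h (runs h r p) = nseq r East ++ p.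
Proof.
(* [unruns] stops after a lone run, so decoding beyond a north step needs a nonempty remaining
   code. *)
have nonnil h' r' p' : exists c w, runs h' r' p' = c :: w.
  elim: p' h' r' => [|s p' IH] h' r' /=; first by exists r', [::].
  by case: ifP => _; [exact: IH | eexists; eexists].
elim: p x h r => [|s p IH] x h r; first by [].
rewrite diags_ok_cons; case: s => /=.
- by move=> /IH ->; rewrite -cat_rcons; congr (_ ++ _); elim: (r) => //= r' <-.
- move=> /IH E; case: ifP => _ /=; first by rewrite E.
  by have [c [w Ew]] := nonnil h.+1 0 p; rewrite Ew -Ew E.
by move=> /andP[-> /IH E] /=; rewrite E.
Qed.

Lemma diags_ok_nseq x h r p :
  diags_ok (x + r, h) p -> diags_ok (x, h) (nseq r East ++ p).
Proof.
elim: r x => [|r IH] x /=; rewrite ?addn0 // addnS -addSn => /IH.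
by [].
Qed.

Lemma diags_ok_unruns x h w : diags_ok (x, h) (unruns h w).
Proof.
have [m] := ubnP (size w); elim: m w x h => // m IH [|r [|d w]] x h /= sz.
- by [].
- exact: diags_ok_nseq.
apply: diags_ok_nseq; case: ifP => dv; last first.
  by rewrite diags_ok_cons; apply: (IH (d :: w) (x + r) h.+1).
by case: ifP => _; rewrite diags_ok_cons dv; apply: IH; lia.
Qed.


(** * Staying above the line as feasibility *)

Definition above_from (q : nat * nat) (p : seq step) : bool :=
  all (weakly_above k) (q :: scanl move q p).

(* [b] is the size of the stack before the current run, which already counts
   [r] steps, is pushed: [(h + h %/ k).+1] letters precede this run. *)
Lemma above_from_runs x h r b p : diags_ok (x, h) p ->
  b + k.+1 * x = (h + h %/ k).+1 + k.+1 * r ->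
  above_from (x, h) p = feasible k b (runs h r p).
Proof.
have head_above q s p' : above_from q (s :: p') =
    weakly_above k q && above_from (move q s) p' by [].
have above0 q p' : above_from q p' -> weakly_above k q by case/andP.
have aboveE x' h' : weakly_above k (x', h') = (k.+1 * x' <= (h' + h' %/ k).+1).
  by rewrite above_slot.
elim: p x h r b => [|s p IH] x h r b ok E.
  by rewrite /above_from /= !andbT aboveE; lia.
rewrite head_above; move: ok; rewrite diags_ok_cons; case: s => /=.
- move=> ok; rewrite (IH x.+1 h r.+1 b ok); last by lia.
  (* If the path is above the line after an east step, it was above it before. *)
  rewrite andb_idl //; rewrite -(IH x.+1 h r.+1 b ok); last by lia.
  by move=> /above0; rewrite /weakly_above /=; lia.
- move=> ok; rewrite aboveE.
  have -> : (k.+1 * x <= (h + h %/ k).+1) = (k.+1 * r <= b) by lia.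
  case: leqP => //= leb; have E' := slotS h.
  case: ifP E' => /= dv E'; rewrite ?muln0 ?subn0.
    by rewrite (IH x h.+1 0 (b - k.+1 * r).+2 ok) //; lia.
  by rewrite (IH x h.+1 0 (b - k.+1 * r).+1 ok) //; lia.
move=> /andP[dv ok]; rewrite dv aboveE.
have -> : (k.+1 * x <= (h + h %/ k).+1) = (k.+1 * r <= b) by lia.
case: leqP => //= leb; have E' := slotS h; rewrite dv addn1 in E'.
rewrite muln1; case: (leqP k.+1 (b - k.+1 * r).+1) => [le1|gt1] /=.
  by rewrite (IH x.+1 h.+1 0 ((b - k.+1 * r).+1 - k.+1).+1 ok) //; lia.
(* When the diagonal letter underflows, the end of the diagonal step is below the line. *)
apply/negP => /above0 le_h; have le_x : x.+1 <= h.+1 %/ k by rewrite leq_divRL // mulnC.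
by move: le_h; rewrite /weakly_above /=; lia.
Qed.

Lemma size_runs x h r p : diags_ok (x, h) p ->
  let q := last (x, h) (scanl move (x, h) p) in
  size (runs h r p) + h + h %/ k = (q.2 + q.2 %/ k).+1 /\
  sumn (runs h r p) + x = q.1 + r.
Proof.
elim: p x h r => [|s p IH] x h r; first by rewrite /= addn0; lia.
rewrite diags_ok_cons; case: s => /=.
- by move=> ok; have := IH x.+1 h r.+1 ok; rewrite /=; lia.
- move=> ok; have := IH x h.+1 0 ok; have := slotS h.
  by case: ifP => _ /=; lia.
move=> /andP[dv ok]; have := IH x.+1 h.+1 0 ok; have := slotS h.
by rewrite dv /=; lia.
Qed.

(** * Separating run letters from diagonal letters by position *)

Lemma binary_at_runs h r p : binary_at k (h + h %/ k).+1 (runs h r p).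
Proof.
elim: p h r => [|s p IH] h r /=; first by rewrite binary_at_cons ndvd_slot.
case: ifP => // _; have := IH h.+1 0; rewrite slotS.
case: ifP => dv; rewrite !binary_at_cons ndvd_slot ?addn1 ?addn0 //= => ->.
by case: s; rewrite ?implybT.
Qed.

Lemma ordinary_at_runs h r p :
  ordinary_at k (h + h %/ k).+1 (runs h r p) = east_runs r p.
Proof.
elim: p h r => [|s p IH] h r /=; first by rewrite ordinary_at_cons ndvd_slot.
case: ifP => // _; rewrite -(IH h.+1 0) slotS.
by case: ifP => dv; rewrite !ordinary_at_cons ndvd_slot ?addn1 ?addn0 // dvd_slot dv.
Qed.

(* The hypothesis on the length rules out a word that ends with a letter d_j. *)
Lemma runs_unruns h n (w : seq nat) : w != [::] -> binary_at k (h + h %/ k).+1 w ->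
  size w + h + h %/ k = k.+1 * n + 1 -> runs h 0 (unruns h w) = w.
Proof.
have [m] := ubnP (size w); elim: m w h => // m IH [|r [|d w]] h //= sz _.
  by move=> _ _; rewrite runs_nseq.
rewrite !binary_at_cons ndvd_slot dvd_slot runs_nseq /= add0n.
case: ifP => [dv /andP[led bin] szw | dv bin szw].
  have w_nil : w != [::].
    case: w szw {IH sz bin} => //= E; have := dvd_slot h; rewrite dv.
    have -> : (h + h %/ k).+2 = k.+1 * n + 1 by lia.
    by rewrite dvdn_addr ?dvdn_mulr // dvdn1; case: (k) k_gt0.
  have bin' : binary_at k (h.+1 + h.+1 %/ k).+1 w by rewrite slotS dv addn1.
  have szw' : size w + h.+1 + h.+1 %/ k = k.+1 * n + 1.
    by have := slotS h; rewrite dv addn1; lia.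
  have IHw := IH w h.+1 (ltac:(lia)) w_nil bin' szw'.
  by case: d led {szw sz} => [|[|]] //= _; rewrite dv IHw.
have bin' : binary_at k (h.+1 + h.+1 %/ k).+1 (d :: w).
  by rewrite slotS dv addn0 binary_at_cons dvd_slot dv.
have szw' : size (d :: w) + h.+1 + h.+1 %/ k = k.+1 * n + 1.
  by have := slotS h; rewrite dv /=; lia.
have IHw := IH (d :: w) h.+1 sz isT bin' szw'.
by move: IHw => /=; rewrite dv => ->.
Qed.

(** * Final steps and small paths *)

Lemma last_runs h r q s :
  (last 0 (runs h r (rcons q s)) == 0) = ~~ is_east s.
Proof.
have ne b h' r' p : last b (runs h' r' p) = last 0 (runs h' r' p).
  by elim: p h' r' => [|s' p IH] h' r' //=; case: ifP.
elim: q h r => [|s' q IH] h r /=.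
  by case: s => //=; case: ifP.
by case: ifP => _; first exact: IH; case: ifP => _ /=; rewrite ne IH.
Qed.

Definition avoids_line (q : nat * nat) (p : seq step) : bool :=
  all (fun d => ~~ on_line k d.1 && ~~ on_line k d.2) (diag_steps_from q p).

Lemma avoids_line_cons q s p : avoids_line q (s :: p) =
  (is_diag s ==> ~~ on_line k q && ~~ on_line k (move q s)) &&
  avoids_line (move q s) p.
Proof. by case: s. Qed.

(** With [j = h.+1 %/ k], the right side says [x.+1 < j], while the diagonal step ends on the line
    when [x.+1 = j]. It can start on the line only if it also ends there. *)
Lemma diag_avoids_line x h : k %| h.+1 -> k * x.+1 <= h.+1 ->
  ~~ on_line k (x, h) && ~~ on_line k (x.+1, h.+1) =
  (k.+1 * x.+1 <= (h + h %/ k).+1).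
Proof.
move=> dv; have := slotS h; rewrite dv addn1 => E.
have := divnK dv; move: (h.+1 %/ k) E => j E Ej.
rewrite /on_line /= -Ej mulnC leq_mul2r => le.
have {le} le : x.+1 <= j by lia.
have -> : (h + h %/ k).+1 = k.+1 * j - 1 by lia.
case: (ltngtP x.+1 j) le => // [lt|eqj] _.
  have -> : (k.+1 * x.+1 <= k.+1 * j - 1) by have := leq_mul (leqnn k.+1) lt; lia.
  have := leq_mul (leqnn k) lt => le2.
  by apply/andP; split; apply/eqP; lia.
by rewrite eqj mulnC eqxx andbF; apply/esym/negbTE; lia.
Qed.

(* Here [b] does not count the tree at the bottom of the stack. *)
Lemma avoids_line_runs x h r b p : diags_ok (x, h) p ->
  above_from (x, h) p -> b + k.+1 * x = h + h %/ k + k.+1 * r ->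
  avoids_line (x, h) p = feasible k b (runs h r p).
Proof.
(* Above the line [x' <= h' %/ k], so runs never need the bottom tree; only diagonal letters can. *)
have le_run x' h' r' b' : weakly_above k (x', h') ->
    b' + k.+1 * x' = h' + h' %/ k + k.+1 * r' -> k.+1 * r' <= b'.
  rewrite /weakly_above /= => le; have : x' <= h' %/ k by rewrite leq_divRL // mulnC.
  by lia.
elim: p x h r b => [|s p IH] x h r b ok ab E.
  by rewrite /= (le_run x h r b) //; case/andP: ab.
have ab0 : weakly_above k (x, h) by case/andP: ab.
have {}ab : above_from (move (x, h) s) p by case/andP: ab.
have ab1 : weakly_above k (move (x, h) s) by case/andP: ab.
have leb := le_run x h r b ab0 E.
move: ok; rewrite diags_ok_cons avoids_line_cons => /andP[dv ok].
have E' := slotS h; case: s dv ok ab ab1 => /= dv ok ab ab1.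
- by rewrite (IH x.+1 h r.+1 b ok ab) //; lia.
- rewrite leb; case: ifP E' => /= dv' E'; rewrite ?muln0 ?subn0.
    by rewrite (IH x h.+1 0 (b - k.+1 * r).+2 ok) //; lia.
  by rewrite (IH x h.+1 0 (b - k.+1 * r).+1 ok) //; lia.
rewrite leb dv /= muln1 diag_avoids_line //; rewrite dv addn1 in E'.
have -> : (k.+1 * x.+1 <= (h + h %/ k).+1) = (k.+1 <= (b - k.+1 * r).+1) by lia.
case: (leqP k.+1 (b - k.+1 * r).+1) => //= le1.
by rewrite (IH x.+1 h.+1 0 ((b - k.+1 * r).+1 - k.+1).+1 ok) //; lia.
Qed.

(** * Large paths matched with words *)

Lemma is_large_pathE n p : is_large_path k n p =
  [&& last (0, 0) (scanl move (0, 0) p) == (n, k * n),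
      above_from (0, 0) p & diags_ok (0, 0) p].
Proof.
rewrite /is_large_path; congr [&& _, _ & _]; apply: eq_all => d.
rewrite -(eqn_modDr 1) !addn1 (prednK k_gt0) modnn.
by [].
Qed.

Definition word (p : seq step) : seq nat := 0 :: runs 0 0 p.

Lemma binary_at_word p : binary_at k 0 (word p).
Proof. by rewrite binary_at_cons implybT; have := binary_at_runs 0 0 p; rewrite div0n. Qed.

Lemma is_word_word n p : diags_ok (0, 0) p ->
  is_word k n (word p) = is_large_path k n p.
Proof.
move=> ok; rewrite is_large_pathE ok andbT /is_word binary_at_word.
have -> : feasible k 0 (word p) = above_from (0, 0) p.
  (* The stack size is 1 once [d_0] has been pushed. *)
  by rewrite (@above_from_runs 0 0 0 1) ?div0n ?muln0 //= muln0.
rewrite andTb andbA; congr (_ && _).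
have := size_runs 0 ok; case: (last _ _) => x h /=; rewrite div0n !addn0 => -[szE ->].
rewrite xpair_eqE add0n andbC; case: eqP => //= _.
have -> : ((size (runs 0 0 p)).+1 == 2 + k.+1 * n) = (h + h %/ k == k * n + n).
  by rewrite szE; apply/eqP/eqP; lia.
apply/eqP/eqP => [E|->]; last by rewrite mulKn.
(* [h + h %/ k] is strictly increasing in [h], so the word length determines the final height. *)
have := leq_div2r k; case: (ltngtP h (k * n)) => // lt le.
  by have := le _ _ (ltnW lt); rewrite mulKn //; lia.
by have := le _ _ (ltnW lt); rewrite mulKn //; lia.
Qed.

Lemma word_unruns n w : is_word k n w -> word (unruns 0 (behead w)) = w.
Proof.
case/and4P; case: w => [|c w] //= /eqP sz _.
(* An empty stack forces the leading letter to be 0, so [behead] loses nothing. *)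
rewrite leqn0 muln_eq0 /= binary_at_cons => bin /andP[/eqP c0 _].
rewrite /word (@runs_unruns 0 n); first by rewrite c0.
- by case: w sz {bin}.
- by rewrite div0n; case/andP: bin.
by rewrite div0n; lia.
Qed.

Lemma unruns_word n p : is_large_path k n p -> unruns 0 (behead (word p)) = p.
Proof. by rewrite is_large_pathE => /and3P[_ _ /unruns_runs ->]. Qed.

Lemma is_word_path n p : is_large_path k n p -> is_word k n (word p).
Proof.
by move=> pP; rewrite is_word_word //; move: pP; rewrite is_large_pathE => /and3P[].
Qed.

Lemma is_large_path_unruns n w : is_word k n w ->
  is_large_path k n (unruns 0 (behead w)).
Proof.
by move=> wP; rewrite -is_word_word ?(word_unruns wP) // diags_ok_unruns.
Qed.

Lemma is_small_word n p : is_large_path k n p ->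
  is_small k p = feasible k 0 (behead (word p)).
Proof.
rewrite is_large_pathE => /and3P[_ ab ok].
by rewrite -(@avoids_line_runs 0 0 0 0 p) ?div0n ?muln0.
Qed.

(** The last letter is the length of the final run. A final north step would start just below the
    line, so a last step that is not east is diagonal. *)
Lemma ends_with_diag_word n p : 0 < n -> is_large_path k n p ->
  ends_with_diag p <-> last 0 (word p) = 0.
Proof.
move=> n0; rewrite is_large_pathE => /and3P[/eqP lastp ab _].
case/lastP: p lastp ab => [[E _]|q s]; first by rewrite -E in n0.
rewrite /word [last _ (_ :: _)]/= => lastp ab.
have lastE : last 0 (runs 0 0 (rcons q s)) = 0 <-> ~~ is_east s.
  by rewrite -(last_runs 0 0 q s); split=> /eqP.
rewrite lastE; split=> [[q' /rcons_inj[_ ->]] // | ].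
case: s lastp ab {lastE} => // [|_ _ _]; last by exists q.
rewrite scanl_rcons last_rcons foldl_rcons => lastp.
move/(all_nthP (0, 0))/(_ (size q)); rewrite /= size_scanl size_rcons.
move/(_ (ltnW (ltnSn _))); rewrite nth_cons_scanl ?size_rcons //.
rewrite -cats1 take_size_cat //; case: (foldl _ _ _) lastp => x h [-> hE].
by rewrite /weakly_above /= -hE ltnn.
Qed.

End Coding.

Theorem mainTheorem2 (k : nat) (hk : 1 <= k) (n : nat) (hn : 1 <= n) :
  exists f : large_path k n -> valid_forest n k,
    [/\ bijective f,
        forall p : large_path k n,
          path_type (sval p) = forest_type k (sval (f p)),
        forall p : large_path k n,
          is_small k (sval p) <-> second_tree_single (sval (f p))
      & forall p : large_path k n,
          ends_with_diag (sval p) <-> first_tree_single (sval (f p))].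
Proof.
have wordP (p : large_path k n) : is_word k n (word k (sval p)).
  exact: is_word_path (svalP p).
have plantP (p : large_path k n) := is_valid_forest_plant hk (wordP p).
have readP (F : valid_forest n k) := is_word_reading hk (svalP F).
have readK w : is_word k n w -> reading k (plant k [::] w) = w.
  by case/and4P=> _ _ _; exact: reading_plant.
pose f (p : large_path k n) : valid_forest n k := exist (is_valid_forest n k) _ (plantP p).
pose g (F : valid_forest n k) : large_path k n :=
  exist (is_large_path k n) _ (is_large_path_unruns hk (readP F)).
exists f; split.
- exists g.
    case=> p pP; apply: val_inj; rewrite -[RHS](unruns_word hk pP).
    have E := readK _ (is_word_path hk pP).
    exact: (congr1 (fun w => unruns k 0 (behead w)) E).
  case=> F vF; apply: val_inj.
  apply: (etrans (congr1 (plant k [::]) (word_unruns hk (is_word_reading hk vF)))).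
  by rewrite (plant_reading _ (valid_forest_dvdn vF)).1 cats0.
(* Position 0 holds a diagonal letter, which contributes no part. *)
- move=> p; rewrite (forest_type_plant hk (wordP p)) ordinary_at_cons dvdn0.
  by have := ordinary_at_runs hk 0 0 (sval p); rewrite div0n => ->.
- move=> p; rewrite (is_small_word hk (svalP p)) (second_tree_singleP (plantP p)).
  by rewrite readK.
- move=> p; rewrite (ends_with_diag_word hk hn (svalP p)).
  by rewrite (first_tree_singleP (plantP p)) readK.
Qed.
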